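(* Let $C\ge1$, $y\in\{1,\dots,C\}$, $\kappa>0$, $\theta_1,\dots,\theta_C\in\mathbb{R}$, $\gamma\in\mathbb{R}$ and $w\in\mathbb{R}$. Put $b=\cos(\theta_y+\gamma w)$, $a_y=b$, and $a_c=\cos(\theta_c)$ for $c\ne y$. Let $\Delta=\{\mathbf{P}=(P_1,\dots,P_C): P_c\ge0,\ \sum_{c=1}^C P_c=1\}$ be the $(C-1)$-simplex. Then $$\mathbf{P}^*=\left(\frac{e^{\kappa(a_1-b)}}{\sum_{c=1}^C e^{\kappa(a_c-b)}},\ldots,\frac{e^{\kappa(a_C-b)}}{\sum_{c=1}^C e^{\kappa(a_c-b)}}\right)$$ $$=\arg\max_{\mathbf{P}\in\Delta}\ \kappa\Big[\sum_{c\neq y}P_c\big(\cos(\theta_c)-\cos(\theta_y+\gamma w)\big)+P_y\big(\cos(\theta_y+\gamma w)-\cos(\theta_y+\gamma w)\big)\Big]+\sum_{c=1}^C P_c(-\log P_c),$$ and at $\mathbf{P}=\mathbf{P}^*$ the maximum of this objective equals $$\ell_{AIDGN}=-\log\frac{e^{\kappa\cos(\theta_y+\gamma w)}}{e^{\kappa\cos(\theta_y+\gamma w)}+\sum_{c\neq y}e^{\kappa\cos(\theta_c)}}.$$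
   Context: Convention: $0\log 0=0$. In the paper, $y$ is the correct class of an instance $\mathbf{z}$, $\cos(\theta_c)=\mathbf{w}_c^{\top}\mathbf{z}^*$ is the inner product of the unit vector $\mathbf{w}_c$ with the normalized feature $\mathbf{z}^*=\mathbf{z}/\|\mathbf{z}\|_2$, $\kappa$ is a von Mises–Fisher concentration parameter, and $w=w(r\mid\boldsymbol{\phi},d,y)$ is a real number (a density ratio) depending on the instance; for the theorem these are just real parameters. *)

(* Defs.v *)
From mathcomp Require Import all_boot all_order all_algebra.
From mathcomp Require Import all_classical all_reals all_analysis.

Set Implicit Arguments.
Unset Strict Implicit.
Unset Printing Implicit Defensive.

Import Order.TTheory GRing.Theory Num.Theory.

Local Open Scope classical_set_scope.
Local Open Scope ring_scope.

Definition simplex (R : realType) (C : nat) : set 'rV[R]_C :=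
  [set P | (forall c, 0 <= P ord0 c) /\ \sum_(c < C) P ord0 c = 1].

(* The set of all maximizers; "x = argmax f" for a unique maximizer x is
   [argmax D f = [set x]]. *)
Definition argmax (R : realType) (T : Type) (D : set T) (f : T -> R) : set T :=
  [set x | D x /\ forall z, D z -> f z <= f x].

Section Objective.
Context {R : realType} {C : nat}.
Variables (y : 'I_C) (kappa : R) (theta : 'I_C -> R) (gamma w : R).

Definition margin_cos : R := cos (theta y + gamma * w).

Definition class_cos (c : 'I_C) : R :=
  if c == y then margin_cos else cos (theta c).

Definition Pstar : 'rV[R]_C :=
  \row_(c < C) (expR (kappa * (class_cos c - margin_cos)) /
    \sum_(j < C) expR (kappa * (class_cos j - margin_cos))).

(* The entropy term follows the convention 0 log 0 = 0, since 0 * - ln 0 = 0. *)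
Definition objective (P : 'rV[R]_C) : R :=
  kappa * (\sum_(c < C | c != y)
             P ord0 c * (cos (theta c) - cos (theta y + gamma * w))
           + P ord0 y * (cos (theta y + gamma * w) - cos (theta y + gamma * w)))
  + \sum_(c < C) P ord0 c * (- ln (P ord0 c)).

Definition loss_AIDGN : R :=
  - ln (expR (kappa * cos (theta y + gamma * w)) /
        (expR (kappa * cos (theta y + gamma * w))
         + \sum_(c < C | c != y) expR (kappa * cos (theta c)))).

End Objective.

(* Main.v *)
(** With q = Pstar and Z the normalising sum, every P in the simplex satisfies
    objective P = ln Z - KL(P || q); Gibbs' inequality KL(P || q) >= 0, with
    equality only at P = q, identifies the unique maximizer and the maximum
    ln Z, and factoring exp(- kappa b) out of Z shows that ln Z is the loss. *)
Require Import Defs.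
From mathcomp Require Import all_boot all_order all_algebra.
From mathcomp Require Import all_classical all_reals all_analysis.
From mathcomp Require Import ring lra.

Import Order.TTheory GRing.Theory Num.Theory.

Local Open Scope classical_set_scope.
Local Open Scope ring_scope.

(** For [p > 0] and [p != q] this is the strict bound 1 + x < exp x at x = [ln q - ln p], multiplied
    by [p]. *)
Lemma gibbs_term_leif (R : realType) (p q : R) : 0 <= p -> 0 < q ->
  p * (ln q - ln p) <= q - p ?= iff (p == q).
Proof.
rewrite le_eqVlt => /predU1P[<- q0|p0 q0].
  (* At [p = 0] the left side vanishes whatever the value of [ln 0]. *)
  by rewrite mul0r subr0; split=> //; exact: ltW.
have [->|pq] := eqVneq p q; first by split; rewrite ?subrr ?mulr0 ?eqxx.
have lnqp_neq0 : ln q - ln p != 0.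
  rewrite subr_eq0; apply: contra_neq pq => lnqp.
  by apply/esym/ln_inj.
suff lt_qp : p * (ln q - ln p) < q - p by split; [exact: ltW | exact: lt_eqF].
have := expR_gt1Dx lnqp_neq0.
rewrite expRB !lnK ?posrE// -(ltr_pM2l p0) mulrDr mulr1 [p * (q / p)]mulrC.
by rewrite divfK ?gt_eqF//; lra.
Qed.

(** The termwise bounds add up to zero because the totals agree, and equality of the sums forces
    equality in every term. *)
Lemma gibbs_leif (R : realType) (C : nat) (p q : 'I_C -> R) :
  (forall c, 0 <= p c) -> (forall c, 0 < q c) -> \sum_c p c = \sum_c q c ->
  \sum_c p c * (ln (q c) - ln (p c)) <= 0 ?= iff [forall c, p c == q c].
Proof.
move=> p0 q0 pq.
have := leif_sum (fun c (_ : true) => gibbs_term_leif _ _ _ (p0 c) (q0 c)).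
by rewrite sumrB pq subrr.
Qed.

Section Maximizer.
Context (R : realType) (C : nat) (y : 'I_C) (kappa : R) (theta : 'I_C -> R).
Context (gamma w : R).

Let score c := kappa * (class_cos y theta gamma w c - margin_cos y theta gamma w).
Let Z := \sum_(c < C) expR (score c).
Let q := Pstar y kappa theta gamma w.

Lemma partition_gt0 : 0 < Z.
Proof.
rewrite /Z (bigD1 y)//= ltr_wpDr ?expR_gt0//.
by apply: sumr_ge0 => c _; exact: expR_ge0.
Qed.

Lemma Pstar_gt0 c : 0 < q ord0 c.
Proof. by rewrite mxE divr_gt0 ?expR_gt0 ?partition_gt0. Qed.

Lemma Pstar_simplex : @simplex R C q.
Proof.
split=> [c|]; first exact/ltW/Pstar_gt0.
under eq_bigr do rewrite mxE.
by rewrite -mulr_suml divff// gt_eqF// partition_gt0.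
Qed.

(** Each [ln (q ord0 c)] is [score c] minus the constant [ln Z], and this constant leaves the sum
    with weight one since [P] has total mass one. *)
Lemma objectiveE (P : 'rV[R]_C) : simplex P ->
  objective y kappa theta gamma w P =
  ln Z + \sum_(c < C) P ord0 c * (ln (q ord0 c) - ln (P ord0 c)).
Proof.
move=> [_ P1].
have lnq c : ln (q ord0 c) = score c - ln Z.
  by rewrite mxE ln_div ?posrE ?expR_gt0 ?partition_gt0// expRK.
(* Class [y] rejoins the other classes: [score y] is [kappa] times the zero difference that
   multiplies its coordinate in [objective]. *)
transitivity (\sum_(c < C) (P ord0 c * score c + P ord0 c * - ln (P ord0 c))).
  rewrite /objective big_split/=; congr (_ + _).
  rewrite [RHS](bigD1 y)//= mulrDr [RHS]addrC; congr (_ + _).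
    rewrite mulr_sumr; apply: eq_bigr => c /negPf cy.
    by rewrite /score /class_cos cy mulrCA.
  by rewrite /score /class_cos eqxx mulrCA.
rewrite -[ln Z]mul1r -P1 mulr_suml -big_split/=.
by apply: eq_bigr => c _; rewrite lnq; ring.
Qed.

Lemma objective_leif (P : 'rV[R]_C) : simplex P ->
  objective y kappa theta gamma w P <= ln Z ?= iff (P == q).
Proof.
move=> DP; have [P0 P1] := DP; have [_ q1] := Pstar_simplex.
have [le0 eq0] := gibbs_leif _ _ _ _ P0 Pstar_gt0 (etrans P1 (esym q1)).
rewrite (objectiveE _ DP); split; first by rewrite gerDl.
rewrite -subr_eq0 addrAC subrr add0r eq0.
apply/forallP/eqP => [Pq|-> //]; by apply/rowP => c; apply/eqP.
Qed.

Lemma ln_partitionE : ln Z = loss_AIDGN y kappa theta gamma w.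
Proof.
rewrite /loss_AIDGN -/(margin_cos y theta gamma w); set b := margin_cos _ _ _ _.
(* The minus sign inverts the fraction, leaving two arguments of [ln] to compare term by term. *)
rewrite -lnV ?posrE ?invf_div; last first.
  rewrite divr_gt0 ?expR_gt0// ltr_wpDr ?expR_gt0//.
  by apply: sumr_ge0 => c _; exact: expR_ge0.
congr ln; rewrite /Z (bigD1 y)//= mulrDl mulr_suml; congr (_ + _).
  by rewrite /score /class_cos eqxx -expRB mulrBr.
apply: eq_bigr => c /negPf cy.
by rewrite /score /class_cos cy -expRB mulrBr.
Qed.

End Maximizer.

Theorem theorem3 (R : realType) (C : nat) (hC : (1 <= C)%N) (y : 'I_C)
    (kappa : R) (hkappa : 0 < kappa) (theta : 'I_C -> R) (gamma w : R) :
  argmax (@simplex R C) (objective y kappa theta gamma w)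
    = [set Pstar y kappa theta gamma w] /\
  objective y kappa theta gamma w (Pstar y kappa theta gamma w)
    = loss_AIDGN y kappa theta gamma w.
Proof.
set q := Pstar _ _ _ _ _; set f := objective _ _ _ _ _.
have Dq : simplex q by exact: Pstar_simplex.
have f_leif := @objective_leif R C y kappa theta gamma w.
have fq := eqP (etrans (f_leif _ Dq).2 (eqxx q)).
split; last by rewrite -ln_partitionE.
apply/seteqP; split => [P [DP Pmax]|P ->].
  (* A maximizer has value at least [f q = ln Z], hence exactly [ln Z], and the equality case
     identifies it with [q]. *)
  apply/eqP; rewrite -(f_leif P DP).2 eq_le (f_leif P DP).1 -fq.
  exact: Pmax.
by split=> // P' /f_leif[]; rewrite /f fq.
Qed.
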